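(* Let $n\ge 3$ be even and let $\mathbb{F}$ be a field of characteristic $2$. Let $D_{2n}=\langle a,b\mid a^n=1=b^2,\ (ab)^2=1\rangle$, let $s,t$ be integers with $0\le s\le n-1$, $s\ne 0,\frac n2$, and $0\le t\le n-1$, and let $\sigma_1$ be the $\mathbb{F}$-linear extension to $\mathbb{F}D_{2n}$ of the group endomorphism of $D_{2n}$ given by $\sigma_1(a)=a^s$, $\sigma_1(b)=a^tb$. Denote by $m=|\sigma_1(a)|$ the order of $\sigma_1(a)$, $d=\frac nm$, and let $t\equiv j_0\pmod s$ for some $j_0\in\{0,1,\dots,s-1\}$. Then the dimension of $\mathcal{D}_{\sigma_1}(\mathbb{F}D_{2n})$ over $\mathbb{F}$ is $2(n+2)$, and a basis is the set $\mathcal{B}_1$ of all $D_{(\sigma_1;\bar a,\bar b)}$ where $(\bar a,\bar b)$ ranges over the pairs $$(a^{s+t}b,1),\ (a^{s+t+\frac n2}b,a^{\frac n2}),\ (a^s,a^tb),\ (a^{s+\frac n2},a^{t+\frac n2}b),\ (a^tb,0),\ (a^{t+\frac n2}b,0),\ (1,0),\ (a^{s+\frac n2},0)$$ together with the pairs $$(a^{s+t}(a^i+a^{-i})b,\ a^i+a^{-i}),\quad (a^s(a^i+a^{-i}),\ a^t(a^i+a^{-i})b),\quad (a^t(a^i+a^{-i})b,\ 0),\quad (a^s(a^i+a^{-i}),\ 0)$$ for $1\le i\le \frac n2-1$.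
   Context: A $\sigma$-derivation of $\mathbb{F}D_{2n}$ is an $\mathbb{F}$-linear map $D$ from $\mathbb{F}D_{2n}$ to itself with $D(\alpha\beta)=D(\alpha)\sigma(\beta)+\sigma(\alpha)D(\beta)$ for all $\alpha,\beta$; $\mathcal{D}_\sigma(\mathbb{F}D_{2n})$ is the $\mathbb{F}$-vector space of all of them. A $\sigma$-derivation $D$ is uniquely determined by $D(a)$ and $D(b)$; $D_{(\sigma;\bar a,\bar b)}$ denotes the $\sigma$-derivation with $D(a)=\bar a$ and $D(b)=\bar b$ (part of the assertion is that it exists for each of the listed pairs).
   Formalization: The listed pair (1,0) is replaced by (a^s,0): a σ_1-derivation with D(a)=1, D(b)=0 would give 0=D((ab)^2)=a^s+a^{-s}, which is impossible since s≠0,n/2, so the printed set is not defined. *)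

(* Defs.v *)
From HB Require Import structures.
From mathcomp Require Import all_boot all_fingroup all_solvable all_algebra.
From mathcomp Require classical_sets.

Set Implicit Arguments.
Unset Strict Implicit.
Unset Printing Implicit Defensive.

Import GRing.Theory.
Local Open Scope ring_scope.

(* The group algebra F[gT]: functions gT -> F with the convolution product.   *)
(* [F^o] makes {ffun gT -> F^o} a vectType over F; the alias keeps its        *)
(* pointwise product from being inferred.                                     *)
Definition galg (F : fieldType) (gT : finGroupType) : Type :=
  {ffun gT -> F^o}.

Section GroupAlgebra.
Variables (F : fieldType) (gT : finGroupType).
Implicit Types (x y z : galg F gT) (g h k : gT).

HB.instance Definition _ := Vector.copy (galg F gT) {ffun gT -> F^o}.

Definition galg_fun x : gT -> F := (x : {ffun gT -> F^o}).

Definition gelt g : galg F gT := [ffun h => (h == g)%:R].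

Definition galg_one : galg F gT := gelt 1%g.

Definition galg_mul x y : galg F gT :=
  [ffun k => \sum_h galg_fun x h * galg_fun y (h^-1 * k)%g].

Lemma galgP x y : galg_fun x =1 galg_fun y -> x = y.
Proof. by move=> e; apply/ffunP. Qed.

Lemma galg_funD x y g : galg_fun (x + y) g = galg_fun x g + galg_fun y g.
Proof. by rewrite /galg_fun ffunE. Qed.

Lemma galg_funZ (c : F) x g : galg_fun (c *: x) g = c * galg_fun x g.
Proof. by rewrite /galg_fun ffunE. Qed.

Lemma galg_fun_gelt h g : galg_fun (gelt h) g = (g == h)%:R.
Proof. by rewrite /galg_fun ffunE. Qed.

Lemma galg_fun_mul x y k :
  galg_fun (galg_mul x y) k = \sum_h galg_fun x h * galg_fun y (h^-1 * k)%g.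
Proof. by rewrite {1}/galg_fun ffunE. Qed.

Lemma galg_mulA : associative galg_mul.
Proof.
move=> x y z; apply/galgP => k; rewrite !galg_fun_mul.
under eq_bigr => h _ do rewrite galg_fun_mul mulr_sumr.
under [RHS]eq_bigr => h _ do rewrite galg_fun_mul mulr_suml.
rewrite [RHS]exchange_big /=; apply: eq_bigr => h _.
rewrite [RHS](reindex_inj (mulgI h)) /=; apply: eq_bigr => l _.
by rewrite mulKg invMg -!mulgA mulrA.
Qed.

Lemma galg_mul1l : left_id galg_one galg_mul.
Proof.
move=> x; apply/galgP => k; rewrite galg_fun_mul (bigD1 1%g) //= big1.
  by rewrite galg_fun_gelt eqxx mul1r invg1 mul1g addr0.
by move=> h /negPf hN1; rewrite galg_fun_gelt hN1 mul0r.
Qed.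

Lemma galg_mul1r : right_id galg_one galg_mul.
Proof.
move=> x; apply/galgP => k; rewrite galg_fun_mul (bigD1 k) //= big1.
  by rewrite galg_fun_gelt mulVg eqxx mulr1 addr0.
move=> h hNk; rewrite galg_fun_gelt -eq_mulVg1 eq_sym.
by rewrite eq_sym (negPf hNk) mulr0.
Qed.

Lemma galg_mulDl : left_distributive galg_mul +%R.
Proof.
move=> x y z; apply/galgP => k; rewrite galg_funD !galg_fun_mul -big_split /=.
by apply: eq_bigr => h _; rewrite galg_funD mulrDl.
Qed.

Lemma galg_mulDr : right_distributive galg_mul +%R.
Proof.
move=> x y z; apply/galgP => k; rewrite galg_funD !galg_fun_mul -big_split /=.
by apply: eq_bigr => h _; rewrite galg_funD mulrDr.
Qed.

Lemma galg_one_neq0 : galg_one != 0.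
Proof.
apply/eqP => /(congr1 (fun x => galg_fun x 1%g)).
by rewrite galg_fun_gelt eqxx /galg_fun ffunE => /eqP; rewrite oner_eq0.
Qed.

HB.instance Definition _ := GRing.Zmodule_isNzRing.Build (galg F gT)
  galg_mulA galg_mul1l galg_mul1r galg_mulDl galg_mulDr galg_one_neq0.

Lemma galg_scaleAl (c : F) x y : c *: (x * y) = (c *: x) * y.
Proof.
apply/galgP => k; rewrite galg_funZ !galg_fun_mul mulr_sumr.
by apply: eq_bigr => h _; rewrite galg_funZ mulrA.
Qed.

HB.instance Definition _ :=
  GRing.Lmodule_isLalgebra.Build F (galg F gT) galg_scaleAl.

Lemma galg_scaleAr (c : F) x y : c *: (x * y) = x * (c *: y).
Proof.
apply/galgP => k; rewrite galg_funZ !galg_fun_mul mulr_sumr.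
by apply: eq_bigr => h _; rewrite galg_funZ mulrCA.
Qed.

HB.instance Definition _ :=
  GRing.Lalgebra_isAlgebra.Build F (galg F gT) galg_scaleAr.

Lemma gelt1 : gelt 1 = 1. Proof. by []. Qed.

Lemma geltM g h : gelt (g * h) = gelt g * gelt h.
Proof.
apply/galgP => k; rewrite galg_fun_mul (bigD1 g) //= big1 => [|l lNg].
  by rewrite !galg_fun_gelt eqxx mul1r addr0 -(inj_eq (mulgI g) (g^-1 * k)%g) mulKVg.
by rewrite galg_fun_gelt (negPf lNg) mul0r.
Qed.

Lemma galg_sum_gelt x : x = \sum_g galg_fun x g *: gelt g.
Proof.
apply/galgP => k; rewrite /galg_fun sum_ffunE (bigD1 k) //= big1 => [|l lNk].
  by rewrite !ffunE eqxx addr0; exact: esym (mulr1 _).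
by rewrite !ffunE eq_sym (negPf lNk); exact: mulr0.
Qed.

Lemma galg_ext (V : lmodType F) (f f' : {linear galg F gT -> V}) :
  (forall g, f (gelt g) = f' (gelt g)) -> f =1 f'.
Proof.
move=> eqf x; rewrite [x]galg_sum_gelt !linear_sum; apply: eq_bigr => g _.
by rewrite !linearZ eqf.
Qed.

Definition galg_ext_lin (f : gT -> gT) : 'End(galg F gT) :=
  linfun (fun x : galg F gT => \sum_g galg_fun x g *: gelt (f g)).

Lemma galg_ext_linE f g : galg_ext_lin f (gelt g) = gelt (f g).
Proof.
pose F0 (x : galg F gT) := \sum_g galg_fun x g *: gelt (f g).
have F0_lin : linear F0.
  move=> c x y; rewrite /F0 scaler_sumr -big_split /=; apply: eq_bigr => h _.
  by rewrite galg_funD galg_funZ scalerDl scalerA.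
pose FL := GRing.isLinear.Build F (galg F gT) (galg F gT) *:%R F0 F0_lin.
pose F1 : {linear galg F gT -> galg F gT} := HB.pack F0 FL.
have -> : galg_ext_lin f = linfun F1 by [].
rewrite lfunE /= /F0 (bigD1 g) //= big1 => [|h hNg].
  by rewrite galg_fun_gelt eqxx scale1r addr0.
by rewrite galg_fun_gelt (negPf hNg) scale0r.
Qed.

Definition is_sder (sigma D : 'End(galg F gT)) : Prop :=
  forall x y : galg F gT, D (x * y) = D x * sigma y + sigma x * D y.

Definition sder_defect (sigma : 'End(galg F gT)) (g h : gT)
    (D : 'End(galg F gT)) : galg F gT :=
  D (gelt g * gelt h)
  - (D (gelt g) * sigma (gelt h) + sigma (gelt g) * D (gelt h)).

(* The space of all sigma-derivations; see [sder_spaceP]. *)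
Definition sder_space (sigma : 'End(galg F gT)) :
    {vspace 'End(galg F gT)} :=
  (\bigcap_(g : gT) \bigcap_(h : gT) lker (linfun (sder_defect sigma g h)))%VS.

Lemma sder_defect_linear sigma g h : linear (sder_defect sigma g h).
Proof.
move=> c D D'; rewrite /sder_defect !lfunE /= !lfunE /=.
rewrite mulrDl mulrDr -galg_scaleAl -galg_scaleAr scalerBr scalerDr.
by rewrite addrACA [in RHS]addrACA -opprD.
Qed.

Lemma sder_spaceP sigma D : reflect (is_sder sigma D) (D \in sder_space sigma).
Proof.
have ker_gh g h : (D \in lker (linfun (sder_defect sigma g h))) =
    (sder_defect sigma g h D == 0).
  pose L := GRing.isLinear.Build F _ _ *:%R (sder_defect sigma g h)
              (sder_defect_linear sigma g h).
  pose f : {linear 'End(galg F gT) -> galg F gT} :=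
    HB.pack (sder_defect sigma g h) L.
  have -> : linfun (sder_defect sigma g h) = linfun f by [].
  by rewrite memv_ker lfunE.
apply: (iffP idP) => [Dker | Dder]; last first.
  rewrite /sder_space memvE; apply/subv_bigcapP => g _; apply/subv_bigcapP => h _.
  by rewrite -memvE ker_gh /sder_defect Dder subrr.
have Dgh g h : D (gelt g * gelt h) =
    D (gelt g) * sigma (gelt h) + sigma (gelt g) * D (gelt h).
  move: Dker; rewrite memvE => /subv_bigcapP/(_ g isT)/subv_bigcapP/(_ h isT).
  by rewrite -memvE ker_gh subr_eq0 => /eqP.
have Dgy g y : D (gelt g * y) = D (gelt g) * sigma y + sigma (gelt g) * D y.
  rewrite [y]galg_sum_gelt mulr_sumr !linear_sum !mulr_sumr -big_split /=.
  apply: eq_bigr => h _.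
  by rewrite -galg_scaleAr !linearZ /= Dgh -!galg_scaleAr scalerDr.
move=> x y; rewrite [x]galg_sum_gelt mulr_suml !linear_sum !mulr_suml.
rewrite -big_split /=; apply: eq_bigr => g _.
by rewrite -galg_scaleAl !linearZ /= Dgy -!galg_scaleAl scalerDr.
Qed.

(* D_(sigma; u, v): the sigma-derivation with D(a) = u and D(b) = v, and 0    *)
(* when there is none; it is unique when a and b generate, by [is_sder_inj].  *)
Definition is_sder_at (sigma : 'End(galg F gT)) (a b : gT) (u v : galg F gT)
    (D : 'End(galg F gT)) : Prop :=
  [/\ is_sder sigma D, D (gelt a) = u & D (gelt b) = v].

Definition sder_at (sigma : 'End(galg F gT)) (a b : gT) (u v : galg F gT) :
    'End(galg F gT) :=
  classical_sets.xget 0 (is_sder_at sigma a b u v).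

Lemma is_sder_inj (f : {morphism [set: gT] >-> gT}) a b u v D D' :
  <<[set a; b]>>%g = [set: gT] ->
  is_sder_at (galg_ext_lin f) a b u v D ->
  is_sder_at (galg_ext_lin f) a b u v D' -> D = D'.
Proof.
move=> gen [dD Da Db] [dD' D'a D'b].
have D1 (E : 'End(galg F gT)) : is_sder (galg_ext_lin f) E -> E 1 = 0.
  move=> /(_ 1 1); rewrite mulr1 -gelt1 galg_ext_linE morph1 gelt1 mulr1 mul1r.
  by move/eqP; rewrite -subr_eq0 opprD addNKr oppr_eq0 => /eqP.
have gS : group_set [set g | D (gelt g) == D' (gelt g)].
  apply/group_setP; split=> [|g h].
    by rewrite inE gelt1 !D1.
  by rewrite !inE geltM dD dD' => /eqP-> /eqP->.
have : <<[set a; b]>>%g \subset Group gS.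
  rewrite gen_subG; apply/subsetP => g; rewrite !inE.
  by case/orP => /eqP->; rewrite ?Da ?Db ?D'a ?D'b.
rewrite gen => /subsetP DD'; apply/lfunP => x; apply: galg_ext => g.
by have := DD' g (in_setT _); rewrite inE => /eqP.
Qed.

(* The seventh pair is (a^s, 0), the i = 0 case of the last family, where the *)
(* source prints (1, 0).  No sigma-derivation has D(a) = 1 and D(b) = 0: it   *)
(* would give 0 = D((ab)^2) = a^s + a^-s, although s is neither 0 nor n/2.    *)
Definition basis_pairs (a b : gT) (n s t : nat) :
    seq (galg F gT * galg F gT) :=
  let c i := gelt (a ^+ i) + gelt (a ^- i) in
  let I := iota 1 (n./2 - 1) in
  [:: (gelt (a ^+ (s + t) * b), 1);
      (gelt (a ^+ (s + t + n./2) * b), gelt (a ^+ n./2));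
      (gelt (a ^+ s), gelt (a ^+ t * b));
      (gelt (a ^+ (s + n./2)), gelt (a ^+ (t + n./2) * b));
      (gelt (a ^+ t * b), 0);
      (gelt (a ^+ (t + n./2) * b), 0);
      (gelt (a ^+ s), 0);
      (gelt (a ^+ (s + n./2)), 0)]
  ++ [seq (gelt (a ^+ (s + t)) * c i * gelt b, c i) | i <- I]
  ++ [seq (gelt (a ^+ s) * c i, gelt (a ^+ t) * c i * gelt b) | i <- I]
  ++ [seq (gelt (a ^+ t) * c i * gelt b, 0) | i <- I]
  ++ [seq (gelt (a ^+ s) * c i, 0) | i <- I].

End GroupAlgebra.

(* Main.v *)
From HB Require Import structures.
Require Import Defs.
From mathcomp Require Import all_boot all_fingroup all_solvable all_algebra.
From mathcomp Require classical_sets.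
From mathcomp Require Import zify.

(** Write A, B for the images of a, b under sigma, n = 2h, and let
    D be a sigma-derivation with D(a) = u, D(b) = v, D(ab) = w = A v + u B.
    Applying D to b^2 = 1 and (ab)^2 = 1 gives, in characteristic 2, that v
    commutes with B and w commutes with A B.  Conversely these two conditions
    are enough for D to exist.  Indeed a sigma-derivation is the same thing as
    a multiplicative map g |-> [[sigma g, D g], [0, sigma g]] into 2 x 2
    matrices over the group algebra, so by the presentation of the dihedral
    group ([dihedral_map]) only the three relations have to be checked on
    the matrices of a and b.  The two involutive relations are the two
    commutation conditions, and a^n = 1 is automatic: A^h is central, so the
    square of the h-th power of the matrix of a has corner 2 A^h z = 0
    ([sder_exists]).

    As B is invertible, D is determined by the pair (w, v), with
    u = (w + A v) B, so the space of derivations is the product of the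
    centralizers of A B and of B.  Both A B = a^(s+t) b and B = a^t b are
    reflections, and each of them, together with a, is again a standard pair of
    generators.  The centralizer of a reflection tau is spanned by the orbit
    sums of conjugation by tau, which are the elements c_i tau^e, where e is
    0 or 1 and c_i is a^i for i = 0, h and a^i + a^-i for 0 < i < h.  The orbit
    sums are dual to the coefficients at the representatives a^i tau^e with
    i <= h ([galg_fun_rot_sum], [centralizer_eq0]), and a dual family of
    functionals that separates the points of a space exhibits a basis
    ([basis_of_dual]).  Translating (w, v) = (0, c_i B^e) and
    (w, v) = (c_i (A B)^e, 0) back into (u, v) gives the listed pairs
    ([sder_pairE]), the singled-out ones being those with i = 0 and i = h. *)

Set Implicit Arguments.
Unset Strict Implicit.
Unset Printing Implicit Defensive.

Import GRing.Theory.
Local Open Scope ring_scope.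

(** * Dihedral groups: normal form and universal property *)

Definition dihedral_gens (gT : finGroupType) (n : nat) (a b : gT) : Prop :=
  [/\ <<[set a; b]>>%g = [set: gT], (a ^+ n = 1)%g, (b ^+ 2 = 1)%g
    & ((a * b) ^+ 2 = 1)%g].

Section DihedralNormalForm.

Variables (gT : finGroupType) (n : nat) (a b : gT).
Hypotheses (gens_ab : dihedral_gens n a b) (oG : #|[set: gT]| = n.*2).

Local Open Scope group_scope.

Let a_n : a ^+ n = 1. Proof. by case: gens_ab. Qed.
Let b_2 : b ^+ 2 = 1. Proof. by case: gens_ab. Qed.

Lemma dihedral_n_gt0 : (0 < n)%N.
Proof. by have := cardG_gt0 [set: gT]; rewrite oG; case: n. Qed.

Lemma dihedral_conj k : (a ^+ k) ^ b = a ^- k.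
Proof.
have [_ _ _ ab2] := gens_ab.
rewrite conjXg -expVgn; congr (_ ^+ _).
apply/eqP; rewrite eq_sym eq_invg_mul conjgE; apply/eqP.
have -> : b^-1 = b by apply/eqP; rewrite eq_invg_mul -expg2 b_2.
by rewrite -ab2 expg2 !mulgA.
Qed.

Lemma dihedral_comm k : b * a ^+ k = a ^- k * b.
Proof. by rewrite [RHS]conjgC conjVg dihedral_conj invgK. Qed.

Lemma dihedral_commV k : b * a ^- k = a ^+ k * b.
Proof. by rewrite [RHS]conjgC dihedral_conj. Qed.

Lemma dihedral_expV i : (i <= n)%N -> a ^- i = a ^+ (n - i).
Proof.
by move=> le_in; apply/eqP; rewrite eq_invg_mul -expgD subnKC // a_n.
Qed.

(** Replacing b by another reflection keeps the presentation; every statement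
    about b below thereby also holds for the images of b and of ab. *)
Lemma dihedral_rot k : dihedral_gens n a (a ^+ k * b).
Proof.
have [genG _ _ _] := gens_ab.
have aG : a \in <<[set a; a ^+ k * b]>> by rewrite mem_gen // set21.
have invol i : (a ^+ i * b) ^+ 2 = 1.
  by rewrite expg2 -mulgA (mulgA b) dihedral_comm -mulgA -expg2 b_2 mulg1 mulgV.
split=> //; last by rewrite mulgA -expgS invol.
apply/eqP; rewrite eqEsubset subsetT /= -genG gen_subG subUset !sub1set aG /=.
by rewrite -(groupMl _ (groupX k aG)) mem_gen // set22.
Qed.

(** The relations bound the orders of a and b by n and 2, and the order of the
    group forces equality and a trivial intersection. *)
Lemma dihedral_decomp :
  [/\ [set: gT] = <[a]> * <[b]>, #[a] = n & <[a]> :&: <[b]> = 1].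
Proof.
have [genG _ _ _] := gens_ab.
have nab : <[b]> \subset 'N(<[a]>).
  rewrite cycle_subG; apply/normP; rewrite -cycleJ.
  by rewrite -[a in a ^ b]expg1 dihedral_conj cycleV.
have defG : [set: gT] = <[a]> * <[b]>.
  by rewrite -norm_joinEr // joing_idl joing_idr.
have oa : (#[a] <= n)%N by rewrite dvdn_leq ?dihedral_n_gt0 // order_dvdn a_n.
have ob : (#[b] <= 2)%N by rewrite dvdn_leq // order_dvdn b_2.
have arith p q k : (p <= n -> q <= 2 -> 0 < k -> p * q = n.*2 * k ->
    p = n /\ k = 1)%N.
  move=> le_pn le_q2 k_gt0 pqE; have n_gt0 := dihedral_n_gt0.
  have k1 : k = 1%N by have := leq_mul le_pn le_q2; rewrite pqE; nia.
  by split=> //; move: pqE; rewrite k1; nia.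
have [] := arith _ _ #|<[a]> :&: <[b]>| oa ob (cardG_gt0 _).
  by rewrite -oG defG mul_cardG.
move=> eqa eqI.
by split; [|exact: eqa|exact: (card1_trivg eqI)].
Qed.

Lemma dihedral_nf g : exists i e, [/\ (i < n)%N, (e < 2)%N & g = a ^+ i * b ^+ e].
Proof.
have [defG _ _] := dihedral_decomp; have := in_setT g.
rewrite defG => /mulsgP[_ _ /cycleP[i ->] /cycleP[e ->] ->].
exists (i %% n)%N, (e %% 2)%N.
by rewrite !ltn_pmod ?dihedral_n_gt0 // !expg_mod.
Qed.

Lemma dihedral_nf_eq i j (e e' : nat) :
  (a ^+ i * b ^+ e == a ^+ j * b ^+ e') = (i == j %[mod n]) && (e == e' %[mod 2]).
Proof.
have [_ oa tiab] := dihedral_decomp.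
have b_neq1 : b != 1.
  apply/eqP => b1; have [] := dihedral_decomp.
  rewrite b1 cycle1 mulg1 => defG; have := oG; rewrite defG -orderE oa.
  by have := dihedral_n_gt0; lia.
have ob : #[b] = 2%N by apply: nt_prime_order.
rewrite -oa -ob -!eq_expg_mod_order.
apply/eqP/andP => [eqij | [/eqP-> /eqP->] //].
have eqz : a ^- j * a ^+ i = b ^+ e' * b ^- e.
  by apply: (mulIg (b ^+ e)); rewrite -mulgA eqij mulKg mulgKV.
have : a ^- j * a ^+ i \in <[a]> :&: <[b]>.
  by rewrite inE {2}eqz !groupM ?groupV ?mem_cycle.
rewrite tiab => /set1P z1; split.
  by rewrite -(mulKVg (a ^+ j) (a ^+ i)) z1 mulg1.
by rewrite eq_sym eq_mulgV1 -eqz z1.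
Qed.

End DihedralNormalForm.

Section DihedralMap.

Variables (gT : finGroupType) (n : nat) (a b : gT) (R : nzRingType) (X Y : R).
Hypotheses (gens_ab : dihedral_gens n a b) (oG : #|[set: gT]| = n.*2).
Hypotheses (Xn : X ^+ n = 1) (Y2 : Y ^+ 2 = 1) (XY2 : (X * Y) ^+ 2 = 1).

(** The universal property of the presentation, with values in the
    multiplicative monoid of an arbitrary, possibly infinite, ring. *)
Lemma dihedral_map : exists phi : gT -> R,
  {morph phi : g h / (g * h)%g >-> g * h}
  /\ forall i e, phi (a ^+ i * b ^+ e)%g = X ^+ i * Y ^+ e.
Proof.
have n_gt0 := dihedral_n_gt0 oG.
have YX k : Y * X ^+ k = X ^+ (n.-1 * k) * Y.
  have YX1 : Y * X = X ^+ n.-1 * Y.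
    rewrite -[X ^+ _]mulr1 -XY2 expr2 !mulrA -exprSr prednK // Xn mul1r.
    by rewrite -(mulrA _ Y Y) -expr2 Y2 mulr1.
  elim: k => [|k IHk]; first by rewrite muln0 expr0 mulr1 mul1r.
  by rewrite exprSr mulrA IHk -mulrA YX1 mulrA -exprD mulnS addnC.
have ba k : (b * a ^+ k = a ^+ (n.-1 * k) * b)%g.
  rewrite (dihedral_comm gens_ab) expgM -(subn1 n) -(dihedral_expV gens_ab) //.
  by rewrite expVgn.
have XYeq i j e e' : (a ^+ i * b ^+ e = a ^+ j * b ^+ e')%g ->
    X ^+ i * Y ^+ e = X ^+ j * Y ^+ e'.
  move/eqP; rewrite (dihedral_nf_eq gens_ab oG) => /andP[/eqP eqij /eqP eqe].
  rewrite -(expr_mod i Xn) eqij expr_mod //.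
  by rewrite -(expr_mod e Y2) eqe expr_mod.
pose nf (g : gT) := [pick p : 'I_n * 'I_2 | g == (a ^+ p.1 * b ^+ p.2)%g].
pose phi g := if nf g is Some p then X ^+ p.1 * Y ^+ p.2 else 1.
have phiE i e : phi (a ^+ i * b ^+ e)%g = X ^+ i * Y ^+ e.
  rewrite /phi /nf; case: pickP => [p /eqP /XYeq //| no].
  have [j [e' [lt_jn lt_e'2 def_g]]] :=
    dihedral_nf gens_ab oG (a ^+ i * b ^+ e)%g.
  by have := no (Ordinal lt_jn, Ordinal lt_e'2); rewrite /= -def_g eqxx.
exists phi; split=> // g h.
have [i [e [_ lt_e2 ->]]] := dihedral_nf gens_ab oG g.
have [k [l [_ _ ->]]] := dihedral_nf gens_ab oG h.
case: e lt_e2 => [|[|//]] _; rewrite !phiE.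
  by rewrite !expg0 !expr0 !mulg1 !mulr1 mulgA -expgD phiE exprD mulrA.
rewrite !expg1 !expr1 !mulgA -(mulgA _ b) ba mulgA -expgD -mulgA -expgS phiE.
by rewrite exprD exprS !mulrA -(mulrA _ Y (X ^+ _)) YX !mulrA.
Qed.

End DihedralMap.

(** * Linear maps on a group algebra *)

Section LinearExtension.

Variables (F : fieldType) (gT : finGroupType).
Implicit Types (x y : galg F gT) (g h : gT).
Local Notation gelt := (gelt F).

Lemma geltX g k : gelt (g ^+ k) = gelt g ^+ k.
Proof. by elim: k => // k IHk; rewrite expgS exprS geltM IHk. Qed.

Lemma galg_fun_mulr x g k : galg_fun (x * gelt g) k = galg_fun x (k * g^-1)%g.
Proof.
rewrite galg_fun_mul (bigD1 (k * g^-1)%g) //= big1 => [|l].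
  by rewrite galg_fun_gelt invMg invgK mulgKV eqxx mulr1 addr0.
rewrite galg_fun_gelt; case: (l^-1 * k =P g)%g => [<- | _ _]; last by rewrite mulr0.
by rewrite invMg invgK mulVKg eqxx.
Qed.

Lemma galg_fun_mull x g k : galg_fun (gelt g * x) k = galg_fun x (g^-1 * k)%g.
Proof.
rewrite galg_fun_mul (bigD1 g) //= big1 => [|l /negPf lNg].
  by rewrite galg_fun_gelt eqxx mul1r addr0.
by rewrite galg_fun_gelt lNg mul0r.
Qed.

Lemma galg_lin_exists (d : gT -> galg F gT) :
  exists D : 'End(galg F gT), forall g, D (gelt g) = d g.
Proof.
pose F0 (x : galg F gT) := \sum_g galg_fun x g *: d g.
have F0_lin : linear F0.
  move=> c x y; rewrite /F0 scaler_sumr -big_split /=; apply: eq_bigr => h _.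
  by rewrite galg_funD galg_funZ scalerDl scalerA.
pose FL := GRing.isLinear.Build F (galg F gT) (galg F gT) *:%R F0 F0_lin.
pose F1 : {linear galg F gT -> galg F gT} := HB.pack F0 FL.
exists (linfun F1) => g; rewrite lfunE /= /F0 (bigD1 g) //= big1 => [|h hNg].
  by rewrite galg_fun_gelt eqxx scale1r addr0.
by rewrite galg_fun_gelt (negPf hNg) scale0r.
Qed.

Lemma is_sder_gelt (sigma D : 'End(galg F gT)) :
  (forall g h, D (gelt (g * h)) =
     D (gelt g) * sigma (gelt h) + sigma (gelt g) * D (gelt h)) ->
  is_sder sigma D.
Proof.
move=> Dgh.
have Dgy g y : D (gelt g * y) = D (gelt g) * sigma y + sigma (gelt g) * D y.
  rewrite [y]galg_sum_gelt mulr_sumr !linear_sum !mulr_sumr -big_split /=.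
  apply: eq_bigr => h _; rewrite -galg_scaleAr -geltM !linearZ /= Dgh.
  by rewrite -!galg_scaleAr scalerDr.
move=> x y; rewrite [x]galg_sum_gelt mulr_suml !linear_sum !mulr_suml.
rewrite -big_split /=; apply: eq_bigr => g _.
by rewrite -galg_scaleAl !linearZ /= Dgy -!galg_scaleAl scalerDr.
Qed.

Lemma comm_gens (a b : gT) (x : galg F gT) : <<[set a; b]>>%g = [set: gT] ->
  GRing.comm x (gelt a) -> GRing.comm x (gelt b) -> forall y, GRing.comm x y.
Proof.
move=> gen xa xb.
have gS : group_set [set g | x * gelt g == gelt g * x].
  apply/group_setP; split=> [|g h]; first by rewrite inE gelt1 mulr1 mul1r.
  by rewrite !inE geltM mulrA => /eqP-> /eqP xh; rewrite -!mulrA xh.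
have sub : <<[set a; b]>>%g \subset Group gS.
  rewrite gen_subG; apply/subsetP => g; rewrite !inE.
  by case/orP => /eqP->; rewrite ?xa ?xb.
move=> y; rewrite /GRing.comm [y]galg_sum_gelt mulr_sumr mulr_suml.
apply: eq_bigr => g _; rewrite -galg_scaleAr -galg_scaleAl; congr (_ *: _).
by have := subsetP sub g; rewrite gen !inE => /(_ isT) /eqP.
Qed.

End LinearExtension.

(** * The matrix encoding of a derivation *)

Section ToeplitzMatrix.

Variable R : nzRingType.
Implicit Types x y : R.

Definition toeplitz x y : 'M[R]_2 :=
  \matrix_(i, j) if i == j then x else if (i < j)%N then y else 0.

(** With x = sigma g and y = D g, the corner entry is the twisted Leibniz rule. *)
Lemma toeplitzM x y x' y' :
  toeplitz x y * toeplitz x' y' = toeplitz (x * x') (x * y' + y * x').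
Proof.
apply/matrixP => i j; rewrite !mxE !big_ord_recl big_ord0 !mxE /= addr0.
case: i => [[|[|//]] ?]; case: j => [[|[|//]] ?] //=;
  by rewrite -?val_eqE /= ?mulr0 ?mul0r ?addr0 ?add0r.
Qed.

Lemma toeplitz1 : toeplitz 1 0 = 1.
Proof.
apply/matrixP => i j; rewrite !mxE.
by case: eqP => // _; case: ifP.
Qed.

Lemma toeplitzX x y k : exists z, toeplitz x y ^+ k = toeplitz (x ^+ k) z.
Proof.
elim: k => [|k [z IHk]]; first by exists 0; rewrite !expr0 toeplitz1.
by eexists; rewrite !exprS IHk toeplitzM.
Qed.

Lemma toeplitz_inj x y x' y' :
  toeplitz x y = toeplitz x' y' -> x = x' /\ y = y'.
Proof.
move/matrixP => e.
by split; [have := e ord0 ord0 | have := e ord0 ord_max]; rewrite !mxE.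
Qed.

End ToeplitzMatrix.

(** * The centralizer of a reflection in the group algebra *)

Section DihedralAlgebra.

Variables (F : fieldType) (gT : finGroupType) (h : nat) (a b : gT).
Hypotheses (gens_ab : dihedral_gens h.*2 a b) (oG : #|[set: gT]| = h.*2.*2).
Implicit Types (x y : galg F gT) (i : nat).
Local Notation gelt := (gelt F).

(** The orbit sum of g^i under inversion when g has order 2h; for i = 0 and
    i = h the orbit is a single point. *)
Definition rot_sum (g : gT) i : galg F gT :=
  if (i == 0) || (i == h) then gelt (g ^+ i) else gelt (g ^+ i) + gelt (g ^- i).

Local Notation c := (rot_sum a).

Let gen_ab : <<[set a; b]>>%g = [set: gT]. Proof. by case: gens_ab. Qed.
Let h_gt0 : (0 < h)%N. Proof. by have := dihedral_n_gt0 oG; lia. Qed.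

Lemma rot_sum_central i x : GRing.comm (c i) x.
Proof.
move: x; apply: (comm_gens gen_ab).
  rewrite /GRing.comm /rot_sum; case: ifP => _.
    by rewrite -!geltM -expgS -expgSr.
  rewrite mulrDl mulrDr -!geltM -expgS -expgSr; congr (_ + gelt _).
  exact: (commute_sym (commuteV (commuteX i (commute_refl a)))).
rewrite /GRing.comm /rot_sum; have cb := dihedral_comm gens_ab.
case: ifP => [/pred2P[]-> | _].
- by rewrite !expg0 gelt1 mul1r mulr1.
- rewrite -!geltM cb (dihedral_expV gens_ab) -addnn ?leq_addr //.
  by rewrite addnK.
rewrite mulrDl mulrDr -!geltM addrC cb; congr (gelt _ + gelt _).
by rewrite (dihedral_commV gens_ab).
Qed.

(** In the range 0 <= i <= h each orbit of conjugation by b has exactly one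
    representative a^i b^e, so orbit sums and coefficients at the
    representatives are dual to each other. *)
Lemma galg_fun_rot_sum i j (e e' : bool) : (i <= h)%N -> (j <= h)%N ->
  galg_fun (c i * gelt (b ^+ e)) (a ^+ j * b ^+ e')%g = ((i == j) && (e == e'))%:R.
Proof.
move=> le_ih le_jh; have eqg k : (a ^+ j * b ^+ e' == a ^+ k * b ^+ e)%g =
    (j == k %[mod h.*2]) && (e == e').
  by rewrite (dihedral_nf_eq gens_ab oG); case: e e' => [] [].
have modS k : (k < h.*2)%N -> (k %% h.*2 = k)%N by move/modn_small.
have -> : galg_fun (c i * gelt (b ^+ e)) (a ^+ j * b ^+ e')%g =
   (galg_fun (gelt (a ^+ i * b ^+ e)%g) (a ^+ j * b ^+ e')%g
   + (if (i == 0) || (i == h) then 0 else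
     galg_fun (gelt (a ^- i * b ^+ e)%g) (a ^+ j * b ^+ e')%g)).
  rewrite /rot_sum; case: ifP => _; first by rewrite -geltM addr0.
  by rewrite mulrDl -!geltM galg_funD.
rewrite !galg_fun_gelt eqg !modS; try lia.
case: ifP => [_ | i_mid]; first by rewrite addr0 eq_sym.
rewrite (dihedral_expV gens_ab) ?eqg ?modS; try lia.
have /negPf-> : (j != h.*2 - i)%N by lia.
by rewrite addr0 eq_sym.
Qed.

(** An element commuting with b has coefficients invariant under conjugation
    by b, which sends a^i b^e to a^(n-i) b^e; hence the coefficients with
    i <= h determine it. *)
Lemma centralizer_eq0 x : GRing.comm x (gelt b) ->
  (forall i (e : bool), (i <= h)%N -> galg_fun x (a ^+ i * b ^+ e)%g = 0) -> x = 0.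
Proof.
move=> xb x0; have xJ g : galg_fun x (g ^ b)%g = galg_fun x g.
  have := congr1 (fun y => galg_fun y (g * b)%g) xb.
  by rewrite galg_fun_mulr galg_fun_mull mulgK conjgE => ->.
apply/galgP => g; rewrite [RHS](_ : _ = 0); last by rewrite /galg_fun ffunE.
have [i [e [lt_in lt_e2 ->]]] := dihedral_nf gens_ab oG g.
have -> : e = (e == 1)%N :> nat by case: e lt_e2 => [|[]].
have [le_ih|lt_hi] := leqP i h; first exact: x0.
rewrite -xJ conjMg (dihedral_conj gens_ab) (dihedral_expV gens_ab) 1?ltnW //.
rewrite conjXg conjgE mulKg x0 //; lia.
Qed.

End DihedralAlgebra.

(** * Bases from dual functionals *)

Section DualBasis.

Variables (F : fieldType) (vT : vectType F) (I : eqType) (U : {vspace vT}).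
Variables (J : seq I) (X : I -> vT) (l : I -> {linear vT -> F^o}).

(** The difference of v in U and of the combination with coefficients l j v is
    killed by all functionals, hence is 0; this gives generation.  For freeness,
    l j is 1 at X j and vanishes on the span of the other vectors. *)
Lemma basis_of_dual : uniq J ->
  {in J, forall j, X j \in U} ->
  {in J &, forall j k, l j (X k) = (j == k)%:R} ->
  (forall v, v \in U -> {in J, forall j, l j v = 0} -> v = 0) ->
  basis_of U [seq X j | j <- J].
Proof.
move=> uJ XU lX l_inj.
have l_sum j (k : I -> F) : j \in J -> l j (\sum_(i <- J) k i *: X i) = k j.
  move=> jJ; rewrite linear_sum (bigD1_seq j) //= big_seq_cond big1 => [|i].
    by rewrite linearZ /= lX // eqxx addr0; apply: mulr1.
  case/andP=> iJ ij; rewrite linearZ /= lX // eq_sym (negPf ij).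
  exact: mulr0.
rewrite /basis_of; apply/andP; split.
  rewrite eqEsubv; apply/andP; split.
    by apply/span_subvP => _ /mapP[j jJ ->]; apply: XU.
  apply/subvP => v vU; have sumU : \sum_(j <- J) l j v *: X j \in U.
    by rewrite big_seq; apply: memv_suml => j jJ; rewrite memvZ // XU.
  have -> : v = \sum_(j <- J) l j v *: X j.
    apply/eqP; rewrite -subr_eq0; apply/eqP/l_inj; first by rewrite memvB.
    by move=> j jJ; rewrite linearB /= l_sum // subrr.
  rewrite big_seq; apply: memv_suml => j jJ.
  by rewrite memvZ // memv_span // map_f.
elim: J uJ lX {XU l_inj l_sum} => [_ _|j J' IHJ] /=; first by rewrite nil_free.
case/andP=> jJ' uJ' lX; rewrite free_cons IHJ ?andbT //; last first.
  by move=> i k iJ kJ; apply: lX; rewrite inE ?iJ ?kJ orbT.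
have kerJ' : (<<[seq X k | k <- J']>> <= lker (linfun (l j)))%VS.
  apply/span_subvP => _ /mapP[k kJ' ->]; rewrite memv_ker lfunE /=.
  rewrite lX ?inE ?eqxx ?kJ' ?orbT //.
  by case: (j =P k) jJ' => // ->; rewrite kJ'.
apply/negP => /(subvP kerJ'); rewrite memv_ker lfunE /= lX ?inE ?eqxx //.
by rewrite oner_eq0.
Qed.

End DualBasis.

(** * Derivations and pairs of centralizing elements *)

Section Derivations.

Variables (F : fieldType) (gT : finGroupType).
Hypothesis char2 : 2%N \in [pchar F].
Local Notation gelt := (gelt F).

Lemma galg_pchar2 : 2%N \in [pchar (galg F gT)].
Proof. by rewrite pchar_lalg. Qed.

Definition coef_at (y : galg F gT) (g : gT) (D : 'End(galg F gT)) : F^o :=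
  galg_fun (D y) g.

Lemma coef_at_linear y g : linear (coef_at y g).
Proof. by move=> c D D'; rewrite /coef_at !lfunE /= !lfunE galg_funD galg_funZ. Qed.

HB.instance Definition _ y g :=
  GRing.isLinear.Build F 'End(galg F gT) F^o *:%R (coef_at y g)
    (coef_at_linear y g).

Variable f : {morphism [set: gT] >-> gT}.
Local Notation sigma := (galg_ext_lin F f).

(** D(1) = 0, so the Leibniz rule for tau^2 = 1 says that D(tau) and sigma(tau)
    anticommute, which in characteristic 2 means that they commute. *)
Lemma sder_invol_comm D tau : is_sder sigma D -> (tau ^+ 2 = 1)%g ->
  GRing.comm (D (gelt tau)) (gelt (f tau)).
Proof.
move=> derD tau2; have D1 : D 1 = 0.
  have := derD 1 1; rewrite -gelt1 galg_ext_linE morph1 gelt1 !mulr1 mul1r => /eqP.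
  by rewrite addrr_pchar2 ?galg_pchar2 // => /eqP.
have := derD (gelt tau) (gelt tau).
rewrite -geltM -expg2 tau2 gelt1 D1 galg_ext_linE => /esym/eqP.
by rewrite addr_eq0 oppr_pchar2 ?galg_pchar2 // => /eqP.
Qed.

Variables (h s t : nat) (a b : gT).
Hypotheses (gens_ab : dihedral_gens h.*2 a b) (oG : #|[set: gT]| = h.*2.*2).
Hypotheses (fa : f a = (a ^+ s)%g) (fb : f b = (a ^+ t * b)%g).

Let A := gelt (f a).
Let B := gelt (f b).

(** The relations of the presentation hold for the matrices [toeplitz A u] and
    [toeplitz B v], so they define a multiplicative map on the whole group,
    whose corner entry is the required derivation. *)
Lemma sder_exists (u v : galg F gT) :
  GRing.comm v B -> GRing.comm (A * v + u * B) (A * B) ->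
  exists D, is_sder_at sigma a b u v D.
Proof.
move=> vB wAB; have [gen a_n b_2 ab_2] := gens_ab.
have fX (g : gT) k : f (g ^+ k)%g = (f g ^+ k)%g by rewrite morphX ?inE.
have fM (g k : gT) : f (g * k)%g = (f g * f k)%g by rewrite morphM ?inE.
have add0 (x : galg F gT) : x + x = 0 by rewrite addrr_pchar2 ?galg_pchar2.
have B2 : B ^+ 2 = 1 by rewrite -geltX -fX b_2 morph1.
have AB2 : (A * B) ^+ 2 = 1 by rewrite -geltM -fM -geltX -fX ab_2 morph1.
have Y2 : toeplitz B v ^+ 2 = 1.
  by rewrite expr2 toeplitzM vB add0 -expr2 B2 toeplitz1.
have XY2 : (toeplitz A u * toeplitz B v) ^+ 2 = 1.
  by rewrite toeplitzM expr2 toeplitzM wAB add0 -expr2 AB2 toeplitz1.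
(* [rot_sum F h a h] is a^h, so A^h is a power of a central element *)
have Xn : toeplitz A u ^+ h.*2 = 1.
  have [z Xh] := toeplitzX A u h.
  have Ah : A ^+ h = rot_sum F h a h ^+ s.
    by rewrite /rot_sum eqxx orbT -!geltX fa -!expgM mulnC.
  have zA : GRing.comm z (A ^+ h).
    by rewrite Ah; apply/commrX/commr_sym/(rot_sum_central gens_ab).
  rewrite -addnn exprD Xh toeplitzM zA add0.
  by rewrite -exprD addnn -geltX -fX a_n morph1 toeplitz1.
have [phi [phiM phiE]] := dihedral_map gens_ab oG Xn Y2 XY2.
pose d g := phi g ord0 ord_max.
have phid g : phi g = toeplitz (gelt (f g)) (d g).
  have [z phig] : exists z, phi g = toeplitz (gelt (f g)) z.
    have [i [e [_ _ ->]]] := dihedral_nf gens_ab oG g; rewrite phiE.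
    have [x ->] := toeplitzX A u i; have [y ->] := toeplitzX B v e.
    by rewrite toeplitzM fM !fX geltM !geltX; eexists.
  by rewrite /d phig mxE.
have [D Dd] := galg_lin_exists d; exists D; split.
- apply: is_sder_gelt => g k; rewrite !Dd !galg_ext_linE addrC.
  by have := phiM g k; rewrite /= !phid toeplitzM => /toeplitz_inj[].
- have := phiE 1%N 0%N; rewrite expg1 expg0 mulg1 expr1 expr0 mulr1 phid Dd.
  by case/toeplitz_inj.
have := phiE 0%N 1%N; rewrite expg1 expg0 mul1g expr1 expr0 mul1r phid Dd.
by case/toeplitz_inj.
Qed.

(** The two involutive generators: a derivation is determined by its values on
    them, and these values can be prescribed independently of each other in
    the centralizers of their images. *)
Definition invol (x : bool) : gT := if x then b else (a * b)%g.

Definition invol_img (x : bool) : gT := (a ^+ (if x then t else s + t) * b)%g.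

Definition cent_elt (j : bool * bool * nat) : galg F gT :=
  let: (x, e, i) := j in rot_sum F h a i * gelt (invol_img x ^+ e).

(** The values at a and b of the derivation that maps [invol x] to
    [cent_elt (x, e, i)] and the other involution to 0; at a the value is
    (w + A v) B, where v and w are the values at b and ab. *)
Definition sder_pair (j : bool * bool * nat) : galg F gT * galg F gT :=
  let: (x, e, i) := j in
  if x then (A * cent_elt j * B, cent_elt j) else (cent_elt j * B, 0).

Definition sder_index : seq (bool * bool * nat) :=
  [seq (p, i) | p <- [:: (true, false); (true, true); (false, false);
                        (false, true)], i <- iota 0 h.+1].

Lemma f_invol x : f (invol x) = invol_img x.
Proof.
case: x; rewrite /invol /invol_img //.
by rewrite morphM ?inE // fa fb mulgA expgD.
Qed.

Lemma invol2 x : (invol x ^+ 2 = 1)%g.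
Proof. by case: gens_ab => _ _ b_2 ab_2; case: x. Qed.

Lemma image_b_mulK x : x * B * B = x.
Proof.
by rewrite -mulrA -geltM -expg2 -morphX ?inE // (invol2 true) morph1 gelt1 mulr1.
Qed.

Lemma invol_img_gens x : dihedral_gens h.*2 a (invol_img x).
Proof. exact: dihedral_rot. Qed.

Lemma cent_elt_comm x e i : GRing.comm (cent_elt (x, e, i)) (gelt (invol_img x)).
Proof.
apply: commr_sym; apply: commrM.
  exact/commr_sym/(rot_sum_central (invol_img_gens x)).
by rewrite geltX; apply: commrX.
Qed.

Lemma sder_pair_invol j x D :
  is_sder_at sigma a b (sder_pair j).1 (sder_pair j).2 D ->
  D (gelt (invol x)) = if x == j.1.1 then cent_elt j else 0.
Proof.
case: j => [[y e] i] [derD Da Db].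
case: x; rewrite /invol.
  by rewrite Db; case: (y).
rewrite geltM derD Da Db !galg_ext_linE -/A -/B /=.
case: (y) => /=; last by rewrite mulr0 addr0 image_b_mulK.
by rewrite image_b_mulK addrr_pchar2 ?galg_pchar2.
Qed.

Lemma sder_pair_exists j :
  exists D, is_sder_at sigma a b (sder_pair j).1 (sder_pair j).2 D.
Proof.
have AB : A * B = gelt (invol_img false).
  by rewrite -geltM -morphM ?inE // -f_invol.
case: j => [[[] e] i]; apply: sder_exists; rewrite ?AB.
- by rewrite /B (f_invol true); apply: cent_elt_comm.
- rewrite [_.1]/= image_b_mulK addrr_pchar2 ?galg_pchar2 //.
  exact/commr_sym/commr0.
- exact/commr_sym/commr0.
by rewrite [_.1]/= mulr0 add0r image_b_mulK; apply: cent_elt_comm.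
Qed.

(** The coefficients dual to the [cent_elt]s separate derivations: if they
    vanish, so do D(b) and D(ab), and then D(a), as B is invertible. *)
Lemma sder_eq0 D : is_sder sigma D ->
  (forall x e i, (i <= h)%N ->
     galg_fun (D (gelt (invol x))) (a ^+ i * invol_img x ^+ (e : bool))%g = 0) ->
  D = 0.
Proof.
move=> derD D0; have [gen _ _ _] := gens_ab.
have Dinvol x : D (gelt (invol x)) = 0.
  apply: (centralizer_eq0 (invol_img_gens x) oG) => [|i e le_ih]; last exact: D0.
  by rewrite -f_invol; apply: sder_invol_comm (invol2 x).
have Da : D (gelt a) = 0.
  have := derD (gelt a) (gelt b); rewrite -geltM (Dinvol false) (Dinvol true).
  rewrite mulr0 addr0 galg_ext_linE -/B => /(congr1 (fun x => x * B)).
  by rewrite mul0r image_b_mulK.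
apply: (is_sder_inj gen (u := 0) (v := 0)); first by split=> //; apply: (Dinvol true).
by split=> [x y||]; rewrite !lfunE /= ?mul0r ?mulr0 ?addr0.
Qed.

Lemma sder_index_uniq : uniq sder_index.
Proof.
apply: allpairs_uniq => //; first exact: iota_uniq.
by move=> [p i] [p' i'] _ _.
Qed.

Lemma sder_indexP x e i : ((x, e, i) \in sder_index) = (i <= h)%N.
Proof.
apply/allpairsP/idP => [[[p k] [_ k_le [_ ->]]]|le_ih].
  by move: k_le; rewrite mem_iota => /andP[].
exists ((x, e), i); split; rewrite ?mem_iota //.
by case: x e => [] [].
Qed.

(** The functional dual to the derivation of index (x, e, i) is the coefficient
    of its value at [invol x] on the orbit representative. *)
Lemma sder_basis : basis_of (sder_space sigma)
  [seq sder_at sigma a b p.1 p.2 | p <- [seq sder_pair j | j <- sder_index]].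
Proof.
pose der j := sder_at sigma a b (sder_pair j).1 (sder_pair j).2.
have derP j : is_sder_at sigma a b (sder_pair j).1 (sder_pair j).2 (der j).
  by apply: classical_sets.xgetPex; apply: sder_pair_exists.
rewrite -map_comp -[map _ _]/[seq der j | j <- sder_index].
pose l (j : bool * bool * nat) : {linear 'End(galg F gT) -> F^o} :=
  let: (x, e, i) := j in coef_at (gelt (invol x)) (a ^+ i * invol_img x ^+ e)%g.
apply: (basis_of_dual (l := l)); first exact: sder_index_uniq.
- by move=> j _; apply/sder_spaceP; have [] := derP j.
- move=> [[x e] i] [[x' e'] i']; rewrite !sder_indexP => le_ih le_i'h.
  rewrite /= /coef_at (sder_pair_invol x (derP _)) /=.
  rewrite !xpair_eqE; case: eqP => [<-|_] /=; last by rewrite /galg_fun ffunE.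
  rewrite (galg_fun_rot_sum _ (invol_img_gens x) oG) // andbC.
  by rewrite ![_ == i]eq_sym ![_ == e]eq_sym.
move=> D /sder_spaceP derD D0; apply: sder_eq0 => // x e i le_ih.
by apply: (D0 (x, e, i)); rewrite sder_indexP.
Qed.

(** * The listed pairs *)

Local Notation c := (rot_sum F h a).

Lemma sder_pairE i :
  [/\ sder_pair (true, false, i) = (gelt (a ^+ (s + t)) * c i * gelt b, c i),
      sder_pair (true, true, i) = (gelt (a ^+ s) * c i, gelt (a ^+ t) * c i * gelt b),
      sder_pair (false, false, i) = (gelt (a ^+ t) * c i * gelt b, 0)
    & sder_pair (false, true, i) = (gelt (a ^+ s) * c i, 0)].
Proof.
have cC x : c i * x = x * c i by apply: (rot_sum_central gens_ab).
have AE : A = gelt (a ^+ s) by rewrite /A fa.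
have BE : B = gelt (a ^+ t) * gelt b by rewrite /B fb geltM.
have imgE : gelt (invol_img false) = A * B.
  by rewrite -f_invol -geltM -morphM ?inE.
rewrite /sder_pair /cent_elt !expg0 !expg1 !gelt1 !mulr1 imgE -(f_invol true) -/B.
rewrite !mulrA !image_b_mulK; split; congr (_, _).
- by rewrite -!cC AE BE expgD geltM !mulrA.
- by rewrite AE.
- by rewrite -cC BE !mulrA.
- by rewrite -cC BE !mulrA.
by rewrite -cC AE.
Qed.

Lemma basis_pairs_perm :
  perm_eq (basis_pairs F a b h.*2 s t) [seq sder_pair j | j <- sder_index].
Proof.
have h_gt0 : (0 < h)%N by have := dihedral_n_gt0 oG; lia.
have iotaE : iota 0 h.+1 = 0%N :: iota 1 (h - 1) ++ [:: h].
  case: (h) h_gt0 => // k _; rewrite subn1 -[LHS]/(0%N :: iota 1 k.+1).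
  by rewrite -[k.+1]addn1 iotaD add1n addn1.
have c0 : c 0 = 1 by rewrite /rot_sum expg0 gelt1.
have ch : c h = gelt (a ^+ h) by rewrite /rot_sum eqxx orbT.
have inI (Q Q' : nat -> galg F gT * galg F gT) :
    (forall i, c i = gelt (a ^+ i) + gelt (a ^- i) -> Q i = Q' i) ->
    [seq Q i | i <- iota 1 (h - 1)] = [seq Q' i | i <- iota 1 (h - 1)].
  move=> QQ'; apply/eq_in_map => i; rewrite mem_iota => lt_i; apply: QQ'.
  by rewrite /rot_sum; case: ifP => //; lia.
have [p1 p2 p3 p4] := sder_pairE 0; have [q1 q2 q3 q4] := sder_pairE h.
(* the terms with i = 0 and i = h come first on the left, and at the two ends
   of each family on the right *)
have permG (T : eqType) (G : bool * bool * nat -> T) : perm_eq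
    ([:: G (true, false, 0%N); G (true, false, h);
        G (true, true, 0%N); G (true, true, h);
        G (false, false, 0%N); G (false, false, h);
        G (false, true, 0%N); G (false, true, h)]
    ++ [seq G (true, false, i) | i <- iota 1 (h - 1)]
    ++ [seq G (true, true, i) | i <- iota 1 (h - 1)]
    ++ [seq G (false, false, i) | i <- iota 1 (h - 1)]
    ++ [seq G (false, true, i) | i <- iota 1 (h - 1)])
    [seq G j | j <- sder_index].
  rewrite /sder_index iotaE; apply/seq.permP => q.
  have mapG x e (r : seq nat) :
      [seq G j | j <- [seq ((x, e), i) | i <- r]] = [seq G (x, e, i) | i <- r].
    by rewrite -map_comp.
  do 5! rewrite /= ?(map_cat, cats0, count_cat, mapG).
  lia.
have -> : basis_pairs F a b h.*2 s t =
    [:: sder_pair (true, false, 0%N); sder_pair (true, false, h);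
        sder_pair (true, true, 0%N); sder_pair (true, true, h);
        sder_pair (false, false, 0%N); sder_pair (false, false, h);
        sder_pair (false, true, 0%N); sder_pair (false, true, h)]
    ++ [seq sder_pair (true, false, i) | i <- iota 1 (h - 1)]
    ++ [seq sder_pair (true, true, i) | i <- iota 1 (h - 1)]
    ++ [seq sder_pair (false, false, i) | i <- iota 1 (h - 1)]
    ++ [seq sder_pair (false, true, i) | i <- iota 1 (h - 1)].
  rewrite /basis_pairs doubleK p1 p2 p3 p4 q1 q2 q3 q4 c0 ch !mulr1 -!geltM.
  rewrite -!mulgA !expgD -!mulgA.
  congr (_ ++ (_ ++ (_ ++ (_ ++ _)))); apply: inI => i ci; rewrite -ci.
  - by have [-> _ _ _] := sder_pairE i; rewrite expgD.
  - by have [_ -> _ _] := sder_pairE i.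
  - by have [_ _ -> _] := sder_pairE i.
  by have [_ _ _ ->] := sder_pairE i.
exact: permG.
Qed.

End Derivations.

Unset Implicit Arguments.

Theorem theorem5p8 (F : fieldType) (n s t m d j0 : nat)
    (a b : 'D_(n.*2)) (f : {morphism [set: 'D_(n.*2)] >-> 'D_(n.*2)})
    (sigma1 : 'End(galg F 'D_(n.*2))) :
  (3 <= n)%N -> ~~ odd n -> 2%N \in [pchar F] ->
  <<[set a; b]>>%g = [set: 'D_(n.*2)] ->
  (a ^+ n)%g = 1%g -> (b ^+ 2)%g = 1%g -> ((a * b) ^+ 2)%g = 1%g ->
  (s < n)%N -> s <> 0%N -> s <> n./2 -> (t < n)%N ->
  f a = (a ^+ s)%g -> f b = (a ^+ t * b)%g ->
  sigma1 = galg_ext_lin F f ->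
  m = #[f a]%g -> d = (n %/ m)%N ->
  (j0 < s)%N -> t = j0 %[mod s] ->
  [/\ (forall p, p \in basis_pairs F a b n s t ->
         exists D, is_sder_at sigma1 a b p.1 p.2 D),
      \dim (sder_space sigma1) = (2 * (n + 2))%N
    & basis_of (sder_space sigma1)
        [seq sder_at sigma1 a b p.1 p.2 | p <- basis_pairs F a b n s t]].
Proof.
move=> n_ge3 even_n char2 gen a_n b_2 ab_2 _ _ _ _ fa fb -> _ _ _ _.
have oG : #|[set: 'D_(n.*2)]| = n.*2 by apply: card_dihedral; lia.
pose h := n./2; have nE : n = h.*2 by rewrite [RHS]even_halfK.
have gens_ab : dihedral_gens h.*2 a b by rewrite -nE.
have oG' : #|[set: 'D_(n.*2)]| = h.*2.*2 by rewrite -nE.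
have permB := basis_pairs_perm char2 gens_ab oG' fa fb.
rewrite -nE in permB.
have basisB : basis_of (sder_space (galg_ext_lin F f))
    [seq sder_at (galg_ext_lin F f) a b p.1 p.2 | p <- basis_pairs F a b n s t].
  by rewrite (perm_basis _ (perm_map _ permB)); apply: sder_basis gens_ab oG' fa fb.
split=> // [p|].
  rewrite (perm_mem permB) => /mapP[j _ ->].
  exact: sder_pair_exists gens_ab oG' fa fb j.
by rewrite (size_basis basisB); lia.
Qed.
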